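(* Let $r$ and $k$ be fixed nonnegative integers. Then, as $n\to\infty$, the number of $132$-avoiding permutations of $\{1,2,\dots,n\}$ with exactly $r$ occurrences of the pattern $12\dots k$ equals $$\left(\frac{4\sin^2\frac{\pi}{k+1}}{k+1}\right)^{r+1}\frac{n^r}{r!}\left(4\cos^2\frac{\pi}{k+1}\right)^{n-r}\left(1+O\left(\frac1n\right)\right).$$
   Context: For a permutation $\pi=\pi_1\cdots\pi_n$ of $\{1,\dots,n\}$ and a permutation $\sigma=\sigma_1\cdots\sigma_m$ of $\{1,\dots,m\}$, an occurrence of the pattern $\sigma$ in $\pi$ is a choice of indices $i_1<\dots<i_m$ such that $\pi_{i_1}\cdots\pi_{i_m}$ is in the same relative order as $\sigma$; $\pi$ is $\sigma$-avoiding if there is no occurrence. Here $\pi$ in $\sin$ and $\cos$ denotes the number $3.14159\ldots$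
   Formalization: The pair k = 0, r = 1 is excluded: the empty pattern occurs exactly once in every permutation, so the count is the Catalan number, while sin(π) = 0 makes the stated formula 0; all other nonnegative r and k are covered. *)

(* Defs.v *)
From mathcomp Require Import all_boot all_fingroup.

Set Implicit Arguments.
Unset Strict Implicit.
Unset Printing Implicit Defensive.

(* A permutation of {1, ..., n} is an element of 'S_n: positions and values   *)
(* are shifted down by one.                                                   *)

(* The index choice i_1 < ... < i_m is encoded as a strictly increasing map f. *)
Definition occurrence (m n : nat) (s : 'S_m) (p : 'S_n)
    (f : {ffun 'I_m -> 'I_n}) : bool :=
  [forall a : 'I_m, forall b : 'I_m, (a < b) ==> (f a < f b)] &&
  [forall a : 'I_m, forall b : 'I_m, (p (f a) < p (f b)) == (s a < s b)].

Definition occurrences (m n : nat) (s : 'S_m) (p : 'S_n) : nat :=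
  #|[set f : {ffun 'I_m -> 'I_n} | occurrence s p f]|.

Definition avoids (m n : nat) (s : 'S_m) (p : 'S_n) : bool :=
  ~~ [exists f : {ffun 'I_m -> 'I_n}, occurrence s p f].

Definition pattern132 : 'S_3 :=
  tperm (@Ordinal 3 1 isT) (@Ordinal 3 2 isT).

Definition pattern_id (k : nat) : 'S_k := 1%g.

Definition num_av132 (n k r : nat) : nat :=
  #|[set p : 'S_n | avoids pattern132 p & occurrences (pattern_id k) p == r]|.

(* Main.v *)
Require Import Defs.
From mathcomp Require Import all_boot all_order all_algebra all_fingroup.
From mathcomp Require Import all_classical all_reals all_analysis.
From mathcomp Require Import zify ring lra.
Import Order.TTheory GRing.Theory Num.Theory.
Import numFieldNormedType.Exports.

Set Implicit Arguments.
Unset Strict Implicit.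
Unset Printing Implicit Defensive.

(** Let h_i be the number of entries to the right of and larger than the i-th
    entry of a 132-avoiding permutation. These larger entries are increasing,
    so the number of occurrences of 12...k is the sum of the 'C(h_i, k-1), and
    the sequences h that arise are those with last term 0 and h_i <= h_(i+1)+1.
    Equivalently, one counts Dyck paths of length 2n in which an up step from
    height h costs 'C(h, k-1), by total cost r.

    Cost-free paths stay in the strip of heights 0 .. k-1, where the step
    operator has eigenvectors sin(j pi (h+1)/(k+1)) and eigenvalues
    2 cos(j pi/(k+1)). Taking the sine transform of the path counts decouples
    them into scalar recurrences whose source term is the count for cost r-1 at
    height k. By induction on r, the modes j = 1 and j = k, which are equal up
    to the sign (-1)^N, grow like a constant times N^r (2 cos(pi/(k+1)))^N, and
    everything else, including the paths reaching height k+1, is smaller by a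
    factor O(1/N). *)

(** * From permutations to lattice paths *)

Lemma avoids132P n (p : 'S_n) :
  reflect (forall i j l : 'I_n, i < j -> j < l -> p i < p l -> p l < p j -> False)
          (avoids pattern132 p).
Proof.
have s0 (h : 0 < 3) : pattern132 (Ordinal h) = 0 :> nat.
  by rewrite /pattern132 permE /=.
have s1 (h : 1 < 3) : pattern132 (Ordinal h) = 2 :> nat.
  by rewrite /pattern132 permE /=.
have s2 (h : 2 < 3) : pattern132 (Ordinal h) = 1 :> nat.
  by rewrite /pattern132 permE /=.
apply: (iffP idP) => [/existsP av i j l ij jl il lj|av].
  case: av; exists [ffun a : 'I_3 => tnth [tuple i; j; l] a].
  apply/andP; split; apply/forallP => -[[|[|[|//]]] ha];
    apply/forallP => -[[|[|[|//]]] hb]; rewrite !ffunE /tnth /= ?s0 ?s1 ?s2; lia.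
apply/existsP => -[f /andP[/forallP inc /forallP ord]].
have incr (a b : 'I_3) : a < b -> f a < f b by move/forallP: (inc a) => /(_ b)/implyP.
have ordr (a b : 'I_3) : (p (f a) < p (f b)) = (pattern132 a < pattern132 b).
  by move/forallP: (ord a) => /(_ b)/eqP.
pose o i h : 'I_3 := @Ordinal 3 i h.
apply: (av (f (o 0 isT)) (f (o 1 isT)) (f (o 2 isT))); rewrite ?ordr ?s0 ?s1 ?s2 //;
  exact: incr.
Qed.

Definition increasing_on n (p : 'S_n) (A : {set 'I_n}) :=
  [forall i in A, forall j in A, (i < j) ==> (p i < p j)].

Lemma increasing_onP n (p : 'S_n) (A : {set 'I_n}) :
  reflect {in A &, forall i j : 'I_n, i < j -> p i < p j} (increasing_on p A).
Proof.
apply: (iffP forall_inP) => [inc i j Ai Aj ij|inc i Ai].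
  by have /forall_inP/(_ j Aj)/implyP := inc i Ai; apply.
by apply/forall_inP => j Aj; apply/implyP; apply: inc.
Qed.

Lemma enum_ord_sorted n (A : {set 'I_n}) :
  sorted (fun x y : 'I_n => x < y) (enum A).
Proof.
rewrite /enum_mem; apply: sorted_filter; first by move=> y x z; apply: ltn_trans.
by have := iota_ltn_sorted 0 n; rewrite -val_enum_ord sorted_map enumT.
Qed.

(** A strictly increasing map is recovered from its image by sorted enumeration. Sets of positions
    are easy to split by whether they contain the first position. *)
Lemma occurrences_id_sets k n (p : 'S_n) :
  occurrences (pattern_id k) p =
  #|[set A : {set 'I_n} | (#|A| == k) && increasing_on p A]|.
Proof.
pose F := [set f : {ffun 'I_k -> 'I_n} | occurrence (pattern_id k) p f].
pose phi (f : {ffun 'I_k -> 'I_n}) := [set f a | a : 'I_k].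
have FP (f : {ffun 'I_k -> 'I_n}) : reflect ((forall a b : 'I_k, a < b -> f a < f b) /\
                     (forall a b : 'I_k, a < b -> p (f a) < p (f b))) (f \in F).
  rewrite inE; apply: (iffP andP) => [[/forallP i /forallP o]|[i o]].
    split=> a b ab; first by have /forallP/(_ b)/implyP := i a; apply.
    by have /forallP/(_ b)/eqP -> := o a; rewrite !perm1.
  split; apply/forallP => a; apply/forallP => b; first by apply/implyP/i.
  rewrite !perm1; case: (ltngtP a b) => ab; first by rewrite o.
    by apply/eqP/negbTE; rewrite -leqNgt ltnW ?o.
  by rewrite (val_inj ab) ltnn.
have inj (f : {ffun 'I_k -> 'I_n}) : f \in F -> injective f.
  case/FP => i _ a b fab; apply: val_inj; case: (ltngtP a b) => // ab;
  by move: (i _ _ ab); rewrite fab ltnn.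
have lt_irr : irreflexive (fun x y : 'I_n => x < y) by move=> x; rewrite ltnn.
have lt_tr : transitive (fun x y : 'I_n => x < y) by move=> y x z; apply: ltn_trans.
have enum_phi (f : {ffun 'I_k -> 'I_n}) : f \in F -> [seq f a | a <- enum 'I_k] = enum (phi f).
  case/FP => i _; apply: (irr_sorted_eq lt_tr lt_irr).
  - apply: (homo_sorted (e := fun x y : 'I_k => x < y)) => //.
    by have := enum_ord_sorted [set: 'I_k]; rewrite (eq_enum (finset.in_set _)) enumT.
  - exact: enum_ord_sorted.
  - move=> x; rewrite mem_enum; apply/mapP/imsetP => -[a _ ->]; exists a => //.
    by rewrite mem_enum.
have phi_inj : {in F &, injective phi}.
  move=> f g Ff Fg fg; apply/ffunP => a.
  have := enum_phi _ Ff; rewrite fg -enum_phi // => /eq_in_map; apply.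
  by rewrite mem_enum.
rewrite /occurrences -/F -(card_in_imset phi_inj); congr #|pred_of_set _|.
apply/setP => A; rewrite inE; apply/imsetP/andP => [[f Ff ->]|[/eqP ck /increasing_onP inc]].
  split; first by rewrite card_imset ?card_ord //; apply: inj.
  have /FP[i o] := Ff.
  apply/increasing_onP => _ _ /imsetP[a _ ->] /imsetP[b _ ->] ab; apply: o.
  case: (ltngtP a b) => // ba; first by move: (i _ _ ba); rewrite ltnNge ltnW.
  by move: ab; rewrite (val_inj ba) ltnn.
subst k; exists [ffun a => enum_val a].
  have mono (a b : 'I_#|A|) : a < b -> enum_val a < enum_val b.
    move=> ab; have x0 := enum_val a.
    rewrite !(enum_val_nth x0).
    by apply: (sorted_ltn_nth lt_tr x0 (enum_ord_sorted A)); rewrite ?inE -?cardE.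
  apply/FP; split=> a b ab; rewrite !ffunE; first exact: mono.
  by apply: inc; rewrite ?enum_valP ?mono.
apply/setP => x; apply/idP/imsetP => [Ax|[a _ ->]]; last by rewrite ffunE enum_valP.
by exists (enum_rank_in Ax x); rewrite ?ffunE ?enum_rankK_in.
Qed.

Lemma card_ord_geq n m : #|[set j : 'I_n | m <= j]| = n - m.
Proof.
rewrite -sum1dep_card; elim: n => [|n IH]; first by rewrite big_ord0.
rewrite big_mkcond big_ord_recr /= -big_mkcond IH; case: ifP; lia.
Qed.

(** * Adding a first entry to a permutation *)

Section Prepend.
Variables (n : nat) (v : 'I_n.+1) (p : 'S_n).
Let q : 'S_n.+1 := lift_perm ord0 v p.

Lemma prepend0 : q ord0 = v. Proof. exact: lift_perm_id. Qed.
Lemma prepend_lift i : q (lift ord0 i) = lift v (p i). Proof. exact: lift_perm_lift. Qed.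

Lemma ltn_lift (a b : 'I_n) : (lift v a < lift v b) = (a < b).
Proof. by rewrite /= /bump; lia. Qed.

Lemma ltn_liftl (a : 'I_n) : (v < lift v a) = (v <= a).
Proof. by rewrite /= /bump; lia. Qed.

Lemma ordS_case (P : 'I_n.+1 -> Prop) :
  P ord0 -> (forall i, P (lift ord0 i)) -> forall i, P i.
Proof. by move=> P0 PS i; case: (unliftP ord0 i) => [j|] ->. Qed.

(** A new occurrence of 132 must use the prepended entry as its 1. The entries above it come from
    the [p l] with [v <= p l], exactly those raised by [lift v], and they have to increase. *)
Lemma avoids_prependP :
  reflect (avoids pattern132 p /\
           forall j l : 'I_n, j < l -> v <= p l -> p j < p l)
          (avoids pattern132 q).
Proof.
apply: (iffP (avoids132P _)) => [av|[/avoids132P av inc]].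
  split; first apply/avoids132P => i j l ij jl il lj.
    by apply: (av (lift ord0 i) (lift ord0 j) (lift ord0 l));
      rewrite ?prepend_lift ?ltn_lift.
  move=> j l jl vl; rewrite ltnNge leq_eqVlt; apply/negP => /orP[/eqP|] plj.
    by move: jl; rewrite (perm_inj (val_inj plj)) ltnn.
  by apply: (av ord0 (lift ord0 j) (lift ord0 l));
    rewrite ?prepend_lift ?prepend0 ?ltn_lift ?ltn_liftl.
elim/ordS_case => [|i]; elim/ordS_case => [//|j]; elim/ordS_case => [//|l];
  rewrite ?prepend_lift ?prepend0 ?ltn_lift ?ltn_liftl //.
  by move=> _ jl /(inc j l jl) plj; rewrite ltnNge ltnW.
exact: av.
Qed.

Lemma preim_liftK (A : {set 'I_n.+1}) :
  (lift ord0 @: (lift ord0 @^-1: A : {set 'I_n})) = A :\ ord0.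
Proof.
apply/setP; elim/ordS_case => [|i]; rewrite !inE ?eqxx /=.
  by apply/imsetP => -[j _ /eqP]; rewrite (negbTE (neq_lift _ _)).
by rewrite mem_imset ?inE //; apply: lift_inj.
Qed.

(** Occurrences through the new first entry choose [K] further positions among the [n - v] entries
    above it; by avoidance these increase, so every choice works. *)
Lemma occurrences_prepend K : avoids pattern132 q ->
  occurrences (pattern_id K.+1) q = occurrences (pattern_id K.+1) p + 'C(n - v, K).
Proof.
move=> /avoids_prependP[_ inc]; rewrite !occurrences_id_sets.
pose L := lift (@ord0 n); have Linj : injective L by apply: lift_inj.
have L0 (A : {set 'I_n}) : ord0 \notin L @: A.
  by apply/imsetP => -[j _ /eqP]; rewrite (negbTE (neq_lift _ _)).
pose B := [set i | v <= p i].
have cB : #|B| = n - v.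
  rewrite -card_ord_geq -(card_imset _ (@perm_inj _ p)); congr #|pred_of_set _|.
  apply/setP => j; rewrite !inE; apply/imsetP/idP => [[i]|vj]; first by rewrite inE => ? ->.
  by exists (p^-1 j)%g; rewrite ?inE permKV.
rewrite -cB -cards_draws.
set S := [set A | _ & increasing_on q A].
rewrite -(cardsID [set A : {set 'I_n.+1} | ord0 \notin A] S); congr addn.
  have imL : injective (fun A : {set 'I_n} => L @: A) by apply: imset_inj.
  rewrite -(card_imset _ imL); congr #|pred_of_set _|.
  apply/setP => A; rewrite !inE; apply/andP/imsetP => [[/andP[/eqP cA /increasing_onP iA] A0]|].
    have LA : L @: (L @^-1: A) = A.
      rewrite preim_liftK; apply/setP => x; rewrite !inE.
      by case: eqP => // ->; rewrite (negbTE A0).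
    exists (L @^-1: A); last by [].
    rewrite inE -(card_imset _ Linj) LA cA eqxx /=; apply/increasing_onP => i j.
    by rewrite !inE => Ai Aj ij; rewrite -ltn_lift -!prepend_lift iA.
  case=> A'; rewrite inE => /andP[/eqP cA /increasing_onP iA] ->; split=> //.
  rewrite card_imset // cA eqxx; apply/increasing_onP => _ _ /imsetP[i Ai ->] /imsetP[j Aj ->] ij.
  by rewrite !prepend_lift ltn_lift iA.
have imL : injective (fun A : {set 'I_n} => ord0 |: L @: A).
  move=> A A' /= /setP e; apply: (imset_inj Linj); apply/setP => x.
  have := e x; rewrite !inE; case: eqP => // -> _.
  by rewrite !(negbTE (L0 _)).
rewrite -(card_imset _ imL); congr #|pred_of_set _|.
apply/setP => A; rewrite !inE negbK; apply/andP/imsetP => [[A0 /andP[/eqP cA /increasing_onP iA]]|].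
  have LA : ord0 |: L @: (L @^-1: A) = A by rewrite preim_liftK finset.setD1K.
  exists (L @^-1: A); last by [].
  rewrite inE; apply/andP; split.
    apply/fintype.subsetP => i; rewrite !inE => Ai.
    by rewrite -ltn_liftl -prepend_lift -{1}prepend0 iA.
  by move: cA; rewrite -{1}LA cardsU1 L0 card_imset // add1n => -[->].
case=> A'; rewrite inE => /andP[/fintype.subsetP AB /eqP cA] ->; split; first by rewrite !inE eqxx.
rewrite cardsU1 L0 card_imset // cA eqxx; apply/increasing_onP => x y.
case/finset.setU1P => [->|/imsetP[i Ai ->]] /finset.setU1P[->|/imsetP[j Aj ->]] // ij.
  by rewrite prepend_lift prepend0 ltn_liftl; have := AB _ Aj; rewrite inE.
by rewrite !prepend_lift ltn_lift inc //; have := AB _ Aj; rewrite inE.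
Qed.
End Prepend.

(* The number of lattice paths of N unit steps from height h to 0 with total
   cost r, where an up step from height h costs 'C(h, K).                     *)
Fixpoint paths (K N r h : nat) : nat :=
  if N is N'.+1 then
    (if h is h'.+1 then paths K N' r h' else 0) +
    (if 'C(h, K) <= r then paths K N' (r - 'C(h, K)) h.+1 else 0)
  else (r == 0) && (h == 0).

Lemma paths_small K N r h : N < h -> paths K N r h = 0.
Proof.
elim: N r h => [|N IH] r [|h] //= Nh; first by rewrite andbF.
by rewrite IH // IH ?if_same // !ltnS ltnW // ltnW.
Qed.

Lemma paths_diag K r h : paths K h r h = (r == 0).
Proof.
elim: h => [|h IH] /=; first by rewrite andbT.
by rewrite IH paths_small ?if_same ?addn0.
Qed.

(** Classify by the height [i] of the first up step, reached after [h - i] down steps. *)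
Lemma paths_first_rise K m r h :
  paths K (m.+1.*2 + h) r h =
  \sum_(i < h.+1) if 'C(i, K) <= r then paths K (m.*2 + i.+1) (r - 'C(i, K)) i.+1 else 0.
Proof.
elim: h => [|h IH]; first by rewrite big_ord_recr big_ord0 /= !addn0 addn1.
by rewrite big_ord_recr /= -IH doubleS !addSn !addnS /=.
Qed.

(** When entries are read from right to left, this is the height reached by the up step of the first
    entry, hence one more than the number of entries exceeding it. *)
Definition head_height n : 'S_n -> nat :=
  if n is n'.+1 then fun p => n'.+1 - p ord0 else fun=> 0.

Lemma head_height_le n (p : 'S_n) : head_height p <= n.
Proof. by case: n p => //= n p; rewrite leq_subr. Qed.

(** For nonempty [p] the bound says [p ord0 <= v]. If it fails, the value just below [p ord0] is at
    least [v] and lies further right, a descent. If it holds, a descent to a value at least [v]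
    cannot start at the first entry, so it would form a 132 with it. *)
Lemma avoids_prepend n (v : 'I_n.+1) (p : 'S_n) :
  avoids pattern132 (lift_perm ord0 v p) =
  avoids pattern132 p && (n - v < (head_height p).+1).
Proof.
apply/avoids_prependP/andP => -[av].
  move=> inc; split=> //; case: n v p av inc => [|n] v p av inc; first by rewrite ltnS sub0n.
  rewrite ltnS leq_sub2l // leqNgt; apply/negP => vp.
  have ltp : (p ord0).-1 < n.+1 by have := ltn_ord (p ord0); lia.
  set l := (p^-1 (Ordinal ltp))%g; have pl : p l = (p ord0).-1 :> nat by rewrite permKV.
  have l0 : (ord0 : 'I_n.+1) < l.
    rewrite lt0n; apply/eqP => l0; move: pl; rewrite (_ : l = ord0); last exact: val_inj.
    by lia.
  by have := inc ord0 l l0; rewrite pl; lia.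
move=> hv; split=> //; case: n v p av hv => [|n] v p /avoids132P av hv j l jl vl.
  by case: j jl.
have pv : p ord0 <= v by move: hv (ltn_ord (p ord0)) (ltn_ord v); rewrite /=; lia.
have neq (a b : 'I_n.+1) : a < b -> p a != p b :> nat.
  by move=> ab; apply/eqP => /val_inj/perm_inj e; move: ab; rewrite e ltnn.
rewrite ltn_neqAle neq //= leqNgt; apply/negP => lj.
case: (posnP j) => [j0|j0].
  by move: lj; rewrite (_ : j = ord0) ?(leq_gtF (leq_trans pv vl)) //; apply: val_inj.
have l0 : (ord0 : 'I_n.+1) < l by apply: leq_trans jl.
by apply: (av ord0 j l) => //; rewrite ltn_neqAle neq //= (leq_trans pv).
Qed.

Lemma sum_prepend n (F : 'S_n.+1 -> nat) :
  \sum_q F q = \sum_(v < n.+1) \sum_(p : 'S_n) F (lift_perm ord0 v p).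
Proof.
pose h (vp : 'I_n.+1 * 'S_n) := lift_perm ord0 vp.1 vp.2.
have hinj : injective h.
  move=> [v p] [v' p'] /permP /= e; have := e ord0; rewrite !lift_perm_id /= => vv.
  move: e; rewrite -{}vv => e; congr pair; apply/permP => i.
  by have := e (lift ord0 i); rewrite !lift_perm_lift => /lift_inj.
rewrite (reindex h); first by rewrite pair_big.
by apply/onW_bij/inj_card_bij => //; rewrite card_prod !card_Sn card_ord factS.
Qed.

(* Counts the 132-avoiding permutations of size n + m with r occurrences,
   classified by the pattern p of their last n entries.                       *)
Definition completions K r n m :=
  \sum_(p : 'S_n)
    if avoids pattern132 p && (occurrences (pattern_id K.+1) p <= r)
    then paths K (m.*2 + head_height p) (r - occurrences (pattern_id K.+1) p) (head_height p)
    else 0.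

(** For fixed [p], a first up step from height [i] corresponds to prepending the [v] with
    [n - v = i]: [avoids_prepend] gives the range of [i] and [occurrences_prepend] the cost. *)
Lemma completionsS K r n m : completions K r n m.+1 = completions K r n.+1 m.
Proof.
rewrite /completions sum_prepend exchange_big /=; apply: eq_bigr => p _.
rewrite (reindex_inj rev_ord_inj) /=.
set H := head_height p; set o := occurrences (pattern_id K.+1) p.
pose G i := if avoids pattern132 p && (o <= r) then
  (if 'C(i, K) <= r - o then paths K (m.*2 + i.+1) (r - o - 'C(i, K)) i.+1 else 0) else 0.
transitivity (\sum_(i < n.+1) if i < H.+1 then G i else 0); last first.
  apply: eq_bigr => i _; rewrite avoids_prepend /= -/H.
  have ni : n - (n.+1 - i.+1) = i by have := ltn_ord i; lia.
  rewrite ni; case: ltnP => iH; rewrite ?andbT ?andbF // /G.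
  case: (boolP (avoids _ _)) => //= av.
  rewrite occurrences_prepend ?avoids_prepend /= ?av ?ni // -/o lift_perm_id /=.
  have -> : n.+1 - (n.+1 - i.+1) = i.+1 by have := ltn_ord i; lia.
  by case: (leqP o r) => orr; do ?case: ifP => ?; try lia; congr paths; lia.
rewrite -big_mkcond -(big_ord_widen _ G) ?ltnS ?head_height_le // /G.
by case: ifP => _; [exact: paths_first_rise|rewrite big1].
Qed.

(** At [m = 0] the remaining path only descends, so [completions] counts permutations; at size 0 it
    counts whole paths. *)
Lemma num_av132_paths K n r : num_av132 n K.+1 r = paths K n.*2 r 0.
Proof.
have -> : num_av132 n K.+1 r = completions K r n 0.
  rewrite /num_av132 /completions -sum1dep_card big_mkcond; apply: eq_bigr => p _.
  rewrite add0n paths_diag; case: (avoids _ _) => //=.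
  by case: eqP => e; case: leqP => //; lia.
have -> : completions K r n 0 = completions K r 0 n.
  suff E m : completions K r n m = completions K r 0 (n + m) by rewrite E addn0.
  by elim: n m => // n IH m; rewrite -completionsS IH addnS.
rewrite /completions (big_pred1 (1%g : 'S_0)); last first.
  by move=> p; symmetry; apply/eqP/permP => -[].
have av : avoids pattern132 (1%g : 'S_0) by apply/avoids132P => -[].
have oc : occurrences (pattern_id K.+1) (1%g : 'S_0) = 0.
  apply/eqP; rewrite cards_eq0; apply/eqP/setP => f; have := f ord0; by case.
by rewrite av oc /= addn0 subn0.
Qed.

Local Open Scope ring_scope.

(** * Error terms *)

Section ErrorScale.
Variables (R : realFieldType) (rho : R).
Hypotheses (rho_gt0 : 0 < rho) (rho_lt1 : rho < 1).

(* The scale N^(r-1), except that r = 0 gives a geometric decay: it has to be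
   summable, so that summation always raises the order by exactly one.        *)
Definition scale r N : R := if r is r'.+1 then N.+1%:R ^+ r' else rho ^+ N.

(** Errors of lower order than [N ^ r]. The bound holds from [N = 0] on, so no thresholds have to be
    tracked. *)
Definition negl r (f : nat -> R) := exists C, forall N, `|f N| <= C * scale r N.

Lemma scale_gt0 r N : 0 < scale r N.
Proof. by case: r => [|r]; rewrite exprn_gt0 // ltr0n. Qed.

Lemma scale0 r : scale r 0 = 1.
Proof. by case: r => [|r]; rewrite /scale ?expr0 ?expr1n. Qed.

Lemma scaleSr r N : scale r N <= scale r.+1 N.
Proof.
case: r => [|r] /=; first by rewrite expr0 exprn_ile1 // ltW.
by rewrite exprS ler_peMl ?exprn_ge0 // ler1n.
Qed.

Lemma scale_step r N : scale r N.+1 <= 2 ^+ r * scale r N.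
Proof.
case: r => [|r] /=; first by rewrite expr0 mul1r exprS ler_piMl ?exprn_ge0 // ltW.
rewrite exprS -mulrA -exprMn.
have : N.+2%:R ^+ r <= (2 * N.+1%:R) ^+ r :> R.
  by rewrite lerXn2r ?nnegrE ?mulr_ge0 // -natrM ler_nat; lia.
have : 0 <= N.+2%:R ^+ r :> R by rewrite exprn_ge0.
lra.
Qed.

Lemma scale_unstep r N : scale r N <= scale r N.+1 / rho.
Proof.
rewrite ler_pdivlMr //; case: r => [|r] /=; first by rewrite exprSr.
rewrite (@le_trans _ _ (N.+1%:R ^+ r)) ?ler_piMr ?exprn_ge0 ?(ltW rho_lt1) //.
by rewrite lerXn2r ?nnegrE // ler_nat.
Qed.

Lemma scale_mono r N : scale r.+1 N <= scale r.+1 N.+1.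
Proof. by rewrite /= lerXn2r ?nnegrE // ler_nat. Qed.

Lemma sum_geom_le N : \sum_(i < N) rho ^+ i <= (1 - rho)^-1.
Proof.
have D : 0 < 1 - rho by rewrite subr_gt0.
have H : (1 - rho) * \sum_(i < N) rho ^+ i = 1 - rho ^+ N.
  by rewrite -[RHS]opprB subrX1 -mulNr opprB.
by rewrite -(ler_pM2l D) H mulfV ?gt_eqF // gerBl exprn_ge0 // ltW.
Qed.

Lemma sum_scale r N : \sum_(i < N) scale r i <= (1 - rho)^-1 * scale r.+1 N.
Proof.
have D : 1 <= (1 - rho)^-1 by rewrite invf_ge1 ?subr_gt0 // gerBl ltW.
case: r => [|r]; first by rewrite /= expr0 mulr1 sum_geom_le.
apply: (@le_trans _ _ (scale r.+2 N)); last by rewrite ler_peMl ?(ltW (scale_gt0 _ _)).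
apply: (@le_trans _ _ (\sum_(i < N) N.+1%:R ^+ r)).
  by apply: ler_sum => i _ /=; rewrite lerXn2r ?nnegrE // ler_nat ltnS ltnW.
rewrite sumr_const card_ord -[_ *+ N]mulr_natl /= exprS ler_wpM2r ?exprn_ge0 //.
by rewrite ler_nat.
Qed.

Lemma negl_const_ge0 r (f : nat -> R) C : (forall N, `|f N| <= C * scale r N) -> 0 <= C.
Proof. by move=> /(_ 0%N); rewrite scale0 mulr1; apply: le_trans. Qed.

Lemma eq_negl r (f g : nat -> R) : f =1 g -> negl r f -> negl r g.
Proof. by move=> fg [C H]; exists C => N; rewrite -fg. Qed.

Lemma negl0 r : negl r (fun=> 0).
Proof. by exists 0 => N; rewrite normr0 mul0r. Qed.

Lemma neglD r f g : negl r f -> negl r g -> negl r (fun N => f N + g N).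
Proof.
move=> [C1 H1] [C2 H2]; exists (C1 + C2) => N.
by rewrite (le_trans (ler_normD _ _)) // mulrDl lerD.
Qed.

Lemma neglZ c r f : negl r f -> negl r (fun N => c * f N).
Proof.
by move=> [C H]; exists (`|c| * C) => N; rewrite normrM -mulrA ler_wpM2l.
Qed.

Lemma neglB r f g : negl r f -> negl r g -> negl r (fun N => f N - g N).
Proof.
move=> Hf /(neglZ (-1)) Hg; apply: eq_negl (neglD Hf Hg) => N /=.
by rewrite mulN1r.
Qed.

Lemma negl_sum n r (f : nat -> nat -> R) :
  (forall i, (i < n)%N -> negl r (f i)) -> negl r (fun N => \sum_(i < n) f i N).
Proof.
elim: n => [|n IH] H.
  by apply: eq_negl (negl0 r) => N; rewrite big_ord0.
apply: eq_negl (neglD (IH _) (H n _)) => // [N|i ltin]; first by rewrite big_ord_recr.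
exact/H/ltnW.
Qed.

Lemma negl_le r (f g : nat -> R) : (forall N, `|f N| <= `|g N|) -> negl r g -> negl r f.
Proof. by move=> fg [C H]; exists C => N; rewrite (le_trans (fg N)). Qed.

Lemma negl_pred (b : nat -> bool) r f : negl r f -> negl r (fun N => (b N)%:R * f N).
Proof.
by apply: negl_le => N; case: (b N); rewrite ?mul1r ?mul0r ?normr0.
Qed.

Lemma neglS r f : negl r f -> negl r.+1 f.
Proof.
move=> [C H]; exists C => N; apply: le_trans (H N) _.
by rewrite ler_wpM2l ?scaleSr // (negl_const_ge0 H).
Qed.

Lemma neglW r s f : (r <= s)%N -> negl r f -> negl s f.
Proof. by move=> /subnK <-; elim: (s - r)%N => // d IH /IH; apply: neglS. Qed.

Lemma negl_shift r f : negl r f -> negl r (fun N => f N.+1).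
Proof.
move=> [C H]; exists (C * 2 ^+ r) => N; apply: le_trans (H _) _.
by rewrite -mulrA ler_wpM2l ?scale_step // (negl_const_ge0 H).
Qed.

Lemma negl_unshift r f : negl r (fun N => f N.+1) -> negl r f.
Proof.
move=> [C H]; have C0 := negl_const_ge0 H; exists (`|f 0%N| + C / rho) => -[|N].
  by rewrite scale0 mulr1 lerDl divr_ge0 // ltW.
apply: le_trans (H _) _; rewrite mulrDl; apply: ler_wpDl.
  by rewrite mulr_ge0 // ltW // scale_gt0.
by rewrite -mulrA ler_wpM2l // mulrC scale_unstep.
Qed.

(** Telescoping, then [sum_scale]. Differences span two steps because the source driving the mode
    [j = 1] vanishes at every second time. *)
Lemma negl_sum2 r f : negl r (fun N => f N.+2 - f N) -> negl r.+1 f.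
Proof.
move=> [C H]; have C0 := negl_const_ge0 H.
pose A := `|f 0%N| + `|f 1%N|.
have A0 : 0 <= A by rewrite addr_ge0.
have bnd N : `|f N| <= A + C * \sum_(i < N) scale r i /\
             `|f N.+1| <= A + C * \sum_(i < N.+1) scale r i.
  elim: N => [|N [IH1 IH2]].
    rewrite big_ord0 mulr0 addr0 lerDl normr_ge0; split=> //.
    rewrite /A -addrA ler_wpDl // lerDl mulr_ge0 // sumr_ge0 // => i _.
    exact/ltW/scale_gt0.
  split=> //; have -> : f N.+2 = f N + (f N.+2 - f N) by rewrite addrC subrK.
  apply: le_trans (ler_normD _ _) _; rewrite !big_ord_recr /= !mulrDr.
  have := H N; have := mulr_ge0 C0 (ltW (scale_gt0 r N.+1)); lra.
exists (A + C * (1 - rho)^-1) => N; apply: le_trans (bnd N).1 _.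
rewrite mulrDl lerD // -?mulrA ?ler_wpM2l ?sum_scale //.
by rewrite ler_peMr // exprn_ege1 // ler1n.
Qed.

(** The constant [C'] satisfies [|q| C' + C <= C'], so the bound propagates in [N], the scale of
    order [r.+1] being nondecreasing. *)
Lemma negl_contract (q : R) r f :
  `|q| < 1 -> negl r.+1 (fun N => f N.+1 - q * f N) -> negl r.+1 f.
Proof.
move=> q1 [C H]; have C0 := negl_const_ge0 H.
have D : 0 < 1 - `|q| by rewrite subr_gt0.
exists (`|f 0%N| + C / (1 - `|q|)) => N; set C' := _ + _.
have C'0 : 0 <= C' by rewrite addr_ge0 // divr_ge0 // ltW.
have CC' : `|q| * C' + C <= C'.
  have -> : C = (1 - `|q|) * (C / (1 - `|q|)) by rewrite mulrC divfK ?gt_eqF.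
  rewrite {1}/C'; have := mulr_ge0 (ltW D) (normr_ge0 (f 0%N)); rewrite /C'; lra.
elim: N => [|N IH].
  by rewrite scale0 mulr1 /C' lerDl divr_ge0 // ltW.
apply: le_trans (_ : C' * scale r.+1 N <= _); last by rewrite ler_wpM2l ?scale_mono.
apply: le_trans (_ : (`|q| * C' + C) * scale r.+1 N <= _); last first.
  by rewrite ler_wpM2r // ltW // scale_gt0.
have -> : f N.+1 = q * f N + (f N.+1 - q * f N) by rewrite addrC subrK.
rewrite (le_trans (ler_normD _ _)) // mulrDl lerD // normrM -mulrA ler_wpM2l //.
Qed.

Lemma negl_exprn r : negl r.+1 (fun N => N%:R ^+ r).
Proof.
exists 1 => N; rewrite mul1r ger0_norm ?exprn_ge0 //=.
by rewrite lerXn2r ?nnegrE // ler_nat.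
Qed.

Lemma neglM2 r f : negl r.+1 f -> negl r.+2 (fun N => N.+2%:R * f N).
Proof.
move=> [C H]; have C0 := negl_const_ge0 H; exists (2 * C) => N.
rewrite normrM ger0_norm //= exprS mulrACA ler_pM //.
by rewrite -natrM ler_nat; lia.
Qed.

(** If [D] is the difference for one exponent [s], the next one is [(N + 2) D - D + N ^ s]. Exponent
    0 gives zero, as the geometric scale requires. *)
Lemma negl_diff_exprn r : negl r (fun N => N.+1%:R ^+ r - N%:R ^+ r).
Proof.
case: r => [|r]; first by apply: eq_negl (negl0 _) => N; rewrite !expr0 subrr.
elim: r => [|r IH].
  apply: eq_negl (negl_exprn 0) => N.
  by rewrite expr0 !expr1 -natr1 addrAC subrr add0r.
apply: eq_negl (neglD (neglD (neglM2 IH) (neglZ (-1) (neglS IH))) (negl_exprn r.+1)) => N.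
by rewrite -!natr1 !exprS; ring.
Qed.

(** Multiplying the error for [r] by [N + 2] gives the error for [r + 1] up to [4 (r + 1) N ^ r]. *)
Lemma negl_diff2_exprn r :
  negl r (fun N => N.+2%:R ^+ r.+1 - N%:R ^+ r.+1 - 2 * r.+1%:R * N%:R ^+ r).
Proof.
case: r => [|r]; first by apply: eq_negl (negl0 _) => N; rewrite -!natr1; ring.
elim: r => [|r IH].
  apply: eq_negl (neglZ 4 (negl_exprn 0)) => N; rewrite -!natr1; ring.
apply: eq_negl (neglD (neglM2 IH) (neglZ (4 * r.+2%:R) (negl_exprn r.+1))) => N.
by rewrite -!natr1 !exprS; ring.
Qed.

(** Turns an error at time [2 n] into a relative error [O(1 / n)]. For [r = 0], [n] copies of
    [rho ^ (2 n)] lie below a geometric sum; otherwise [2 n + 1 <= 3 n]. *)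
Lemma scale_double r n : scale r n.*2 * n%:R <= (3 ^+ r * (1 - rho)^-1) * n%:R ^+ r.
Proof.
have D : 1 <= (1 - rho)^-1 by rewrite invf_ge1 ?subr_gt0 // gerBl ltW.
case: r => [|r] /=.
  rewrite !expr0 mul1r mulr1; apply: le_trans (sum_geom_le n).
  rewrite mulrC mulr_natl -[n in _ *+ n]card_ord -sumr_const; apply: ler_sum => i _.
  by apply: ler_wiXn2l; rewrite ?(ltW rho_gt0) ?(ltW rho_lt1) //; have := ltn_ord i; lia.
case: n => [|n]; first by rewrite mulr0 expr0n mulr0.
apply: (@le_trans _ _ ((3 * n.+1%:R) ^+ r * n.+1%:R)).
  by rewrite ler_wpM2r // lerXn2r ?nnegrE ?mulr_ge0 // -natrM ler_nat; lia.
have -> : (3 * n.+1%:R) ^+ r * n.+1%:R = 3 ^+ r * n.+1%:R ^+ r.+1 :> R.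
  by rewrite exprMn [in RHS]exprSr mulrA.
rewrite ler_wpM2r ?exprn_ge0 // exprS.
have : 3 ^+ r * 1 <= 3 ^+ r * (1 - rho)^-1 by rewrite ler_wpM2l ?exprn_ge0.
have : 0 <= 3 ^+ r :> R by rewrite exprn_ge0.
lra.
Qed.

End ErrorScale.

(** * Paths in a strip *)

Lemma pathsSS K N r h : paths K N.+1 r h.+1 = (paths K N r h +
  if 'C(h.+1, K) <= r then paths K N (r - 'C(h.+1, K)) h.+2 else 0)%N.
Proof. by []. Qed.

Lemma paths_parity K N r h : odd (N + h) -> paths K N r h = 0%N.
Proof.
elim: N r h => [|N IH] r h /=; first by case: h => // h; rewrite andbF.
move=> oNh; rewrite IH ?if_same ?addn0; last by rewrite addnS.
case: h oNh => // h oNh; apply: IH; move: oNh; rewrite addnS /=.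
by case: odd.
Qed.

(** * Trigonometric sums and the sine transform *)

Section Trigo.
Variable R : realType.
Implicit Types x y : R.

Lemma sin_pin m : sin (pi *+ m) = 0 :> R.
Proof. by have := alternatingn (@sinDpi R) m 0; rewrite add0r sin0 mulr0. Qed.

Lemma cos_pin m : cos (pi *+ m) = (-1) ^+ m :> R.
Proof. by have := alternatingn (@cosDpi R) m 0; rewrite add0r cos0 mulr1. Qed.

Lemma sin_pinB m x : sin (pi *+ m - x) = - (-1) ^+ m * sin x.
Proof. by rewrite sinB sin_pin cos_pin mul0r sub0r mulNr. Qed.

Lemma mul_sin_sin x y : sin x * sin y = (cos (x - y) - cos (x + y)) / 2.
Proof. by rewrite cosB cosD; field. Qed.

Lemma sinDB x y : sin (x + y) + sin (x - y) = 2 * cos y * sin x.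
Proof. by rewrite sinB sinD; ring. Qed.

Lemma sum_cos x M :
  2 * sin (x / 2) * (\sum_(j < M) cos (x *+ j)) = sin (x *+ M - x / 2) + sin (x / 2).
Proof.
elim: M => [|M IH]; first by rewrite big_ord0 mulr0n sub0r sinN mulr0 addNr.
rewrite big_ord_recr /= mulrDr IH.
have -> : x *+ M.+1 - x / 2 = x *+ M + x / 2 by rewrite mulrSr; field.
by rewrite sinB sinD; ring.
Qed.
End Trigo.

Section SineTransform.
Variables (R : realType) (M : nat).
Let theta : R := pi / M.+1%:R.

Lemma thetaM : theta *+ M.+1 = pi.
Proof. by rewrite /theta -[LHS]mulr_natr divfK ?pnatr_eq0. Qed.

Lemma sin_theta_gt0 m : (0 < m <= M)%N -> 0 < sin (theta *+ m).
Proof.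
case/andP=> m0 mM; apply: sin_gt0_pi; rewrite -thetaM.
have t0 : 0 < theta by rewrite divr_gt0 ?pi_gt0 ?ltr0n.
by rewrite pmulrn_lgt0 // t0 ltr_pMn2l.
Qed.

Lemma sum_cos_theta m : (0 < m < M.+1.*2)%N ->
  \sum_(j < M.+1) cos (theta *+ m *+ j) = (1 - (-1) ^+ m) / 2.
Proof.
case/andP=> m0 mM; have := sum_cos (theta *+ m) M.+1.
rewrite -[_ *+ m *+ M.+1]mulrnAC thetaM sin_pinB.
have t0 : 0 < theta by rewrite divr_gt0 ?pi_gt0 ?ltr0n.
have s0 : 0 < sin (theta *+ m / 2).
  apply: sin_gt0_pi; rewrite divr_gt0 ?ltr0n ?pmulrn_lgt0 //=.
  rewrite ltr_pdivrMr ?ltr0n // mulr_natr -thetaM -mulrnA ltr_pMn2l //.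
  by rewrite muln2.
move=> H; apply: (mulfI (lt0r_neq0 (mulr_gt0 (ltr0n R 2) s0))); rewrite H; by field.
Qed.

(** Products become cosine sums at [a - b] and [a + b]. These have equal parity, so by
    [sum_cos_theta] they cancel unless [a = b]. *)
Lemma sine_orthogonal a b : (0 < a <= M)%N -> (0 < b <= M)%N ->
  \sum_(j < M.+1) sin (theta *+ (j * a)) * sin (theta *+ (j * b)) =
  (a == b)%:R * M.+1%:R / 2.
Proof.
wlog ab : a b / (b <= a)%N.
  move=> W ha hb; case/orP: (leq_total b a) => ab; first exact: W.
  by rewrite eq_sym -W //; apply: eq_bigr => j _; rewrite mulrC.
move=> /andP[a0 aM] /andP[b0 bM].
transitivity ((\sum_(j < M.+1) cos (theta *+ (a - b) *+ j)
            - \sum_(j < M.+1) cos (theta *+ (a + b) *+ j)) / 2).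
  rewrite -sumrB mulr_suml; apply: eq_bigr => j _; rewrite mul_sin_sin.
  by rewrite -mulrnBr ?leq_mul2l ?ab ?orbT // -mulrnDr -mulnBr -mulnDr -!mulrnA !(mulnC j).
rewrite (sum_cos_theta (m := a + b)); last by lia.
case: (eqVneq a b) => [->|nab].
  rewrite subnn mulr0n; under eq_bigr do rewrite mul0rn cos0.
  rewrite sumr_const card_ord addnn -mul2n exprM sqrrN expr1n expr1n subrr mul0r subr0 mul1r.
  by [].
rewrite sum_cos_theta; last by lia.
have -> : (-1) ^+ (a + b) = (-1) ^+ (a - b) :> R.
  rewrite -{1}(subnK ab) -addnA addnn exprD -mul2n exprM sqrrN expr1n expr1n mulr1 //.
by rewrite subrr mul0r !mul0r.
Qed.
End SineTransform.

(** * Sine modes of the walk in the strip *)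

Section Strip.
Variables (R : realType) (L : nat).
(** Here [k = L.+2]: the angle is [pi / (k + 1)] and up steps cost ['C(h, k - 1)]. *)
Let theta : R := pi / L.+3%:R.
Let S (m : nat) := sin (theta *+ m).
Let P (r N h : nat) : R := (paths L.+1 N r h)%:R.
(* The sine transform diagonalises the walk confined to heights 0 .. L+1. *)
Let X r N j := \sum_(h < L.+2) S (j * h.+1) * P r N h.

Let theta_pi : theta *+ L.+3 = pi. Proof. exact: thetaM. Qed.

Let theta_gt0 : 0 < theta. Proof. by rewrite divr_gt0 ?pi_gt0 ?ltr0n. Qed.

Let S0 : S 0 = 0. Proof. by rewrite /S mulr0n sin0. Qed.

Let S_step j h : S (j * h.+2) + S (j * h) = 2 * cos (theta *+ j) * S (j * h.+1).
Proof.
rewrite -sinDB /S; congr (sin _ + sin _); first by rewrite -mulrnDr mulnS addnC.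
by rewrite mulnS mulrnDr addrAC subrr add0r.
Qed.

Let S_top j : S (j * L.+3) = 0.
Proof. by rewrite /S mulnC mulrnA theta_pi sin_pin. Qed.

Let S_reflect m : S (L.+2 * m.+1) = (-1) ^+ m * S m.+1.
Proof.
have e : theta *+ (L.+2 * m.+1) = pi *+ m.+1 - theta *+ m.+1.
  by rewrite -theta_pi -mulrnA -mulrnBr ?leq_pmull // -[L.+3]/(1 + L.+2)%N mulnDl mul1n addKn.
by rewrite /S e sin_pinB exprS mulN1r opprK.
Qed.

Let S_last : S L.+2 = S 1.
Proof. by have := S_reflect 0; rewrite muln1 expr0 mul1r. Qed.

Let S1_gt0 : 0 < S 1.
Proof. exact: sin_theta_gt0. Qed.

(** The shifted sums close up because the sine vanishes at both ends, [S0] and [S_top]. What remains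
    is the up step leaving the top height [L.+1], of cost 1. *)
Let X_step r N j :
  X r N.+1 j = 2 * cos (theta *+ j) * X r N j +
    (if r is r'.+1 then S (j * L.+2) * P r' N L.+2 else 0).
Proof.
pose down h : R := if h is h'.+1 then P r N h' else 0.
pose up h : R := if ('C(h, L.+1) <= r)%N then P (r - 'C(h, L.+1))%N N h.+1 else 0.
have -> : X r N.+1 j = \sum_(h < L.+2) S (j * h.+1) * down h
                     + \sum_(h < L.+2) S (j * h.+1) * up h.
  rewrite -big_split; apply: eq_bigr => -[h hh] _ /=; rewrite -mulrDr; congr (_ * _).
  by rewrite /P /down /up natrD; case: h hh => [|h] hh //; case: ifP.
have -> : \sum_(h < L.+2) S (j * h.+1) * down h = \sum_(h < L.+2) S (j * h.+2) * P r N h.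
  rewrite big_ord_recl mulr0 add0r [in RHS]big_ord_recr /= S_top mul0r addr0.
  by apply: eq_bigr.
have -> : \sum_(h < L.+2) S (j * h.+1) * up h = \sum_(h < L.+2) S (j * h) * P r N h +
    (if r is r'.+1 then S (j * L.+2) * P r' N L.+2 else 0).
  rewrite big_ord_recr /= [in RHS]big_ord_recl /= muln0 S0 mul0r add0r.
  congr (_ + _).
    by apply: eq_bigr => -[h hh] _; rewrite /up /= bin_small // subn0.
  by rewrite /up binn; case: (r) => [|r'] /=; rewrite ?mulr0 // subn1.
rewrite addrA -big_split /= mulr_sumr; congr (_ + _).
by apply: eq_bigr => h _; rewrite -mulrDl S_step mulrA.
Qed.

Let P_inv r N h : (h < L.+2)%N ->
  P r N h = 2 / L.+3%:R * \sum_(j < L.+3) S (j * h.+1) * X r N j.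
Proof.
move=> hL; under eq_bigr do rewrite mulr_sumr.
rewrite exchange_big /=.
transitivity (2 / L.+3%:R * \sum_(i < L.+2) (i == h :> nat)%:R * L.+3%:R / 2 * P r N i).
  rewrite (bigD1 (Ordinal hL)) //= eqxx big1 ?addr0.
    have : L.+3%:R != 0 :> R by rewrite pnatr_eq0.
    by move=> ?; rewrite mul1r; field.
  by move=> i; rewrite -val_eqE /= => /negbTE->; rewrite !mul0r.
congr (_ * _); apply: eq_bigr => i _.
under eq_bigr do rewrite mulrA.
rewrite -mulr_suml sine_orthogonal ?ltnS //=.
  by rewrite eqSS eq_sym.
by rewrite -ltnS ltn_ord.
Qed.

(** By parity only heights with [(-1) ^ h = (-1) ^ N] contribute. *)
Let X_top r N : X r N L.+2 = (-1) ^+ N * X r N 1.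
Proof.
rewrite mulr_sumr; apply: eq_bigr => h _; rewrite S_reflect mul1n /P.
case: (boolP (odd (N + h))) => [oNh|]; first by rewrite paths_parity // !mulr0.
rewrite oddD => eNh; rewrite mulrA -signr_odd -[(-1) ^+ N]signr_odd.
by case: (odd N) eNh; case: (odd h).
Qed.

(** The dominant eigenvalue; after division by [mu ^ N], mode [j] has multiplier [q j], and
    [q 1 = 1]. *)
Let mu : R := 2 * cos theta.
Let q j : R := cos (theta *+ j) / cos theta.
Let zeta r N h := P r N h / mu ^+ N.
Let z r N j := X r N j / mu ^+ N.

Let cos_gt0 : 0 < cos theta.
Proof.
apply: cos_gt0_pihalf; apply/andP; split.
  by apply: lt_trans theta_gt0; rewrite oppr_lt0 divr_gt0 ?pi_gt0.
by rewrite ltr_pM2l ?pi_gt0 // ltf_pV2 ?posrE ?ltr0n // ltr_nat.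
Qed.

Let mu_gt0 : 0 < mu. Proof. by rewrite mulr_gt0. Qed.
Let mu_neq0 : mu != 0. Proof. exact: lt0r_neq0. Qed.

(** The cosine decreases strictly on [[0, pi]], and [- cos theta] is its value at
    [theta *+ L.+2]. *)
Let q_lt1 i : (i < L)%N -> `|q i.+2| < 1.
Proof.
move=> iL; rewrite normrM normfV (gtr0_norm cos_gt0) ltr_pdivrMr // mul1r.
have in_pi m : (m <= L.+3)%N -> theta *+ m \in `[0, pi].
  move=> mL; rewrite in_itv; apply/andP; split; first exact: mulrn_wge0 (ltW theta_gt0).
  by rewrite /= -theta_pi ler_pMn2l.
rewrite ltr_norml; apply/andP; split.
  have -> : - cos theta = cos (theta *+ L.+2).
    have -> : theta *+ L.+2 = pi *+ 1 - theta by rewrite mulr1n -theta_pi [in RHS]mulrSr addrK.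
    by rewrite cosB sin_pin cos_pin mul0r addr0 expr1 mulN1r.
  by rewrite ltr_cos ?in_pi ?ltr_pMn2l //; lia.
by rewrite -[ltRHS](_ : cos (theta *+ 1) = _) // ltr_cos ?in_pi ?ltr_pMn2l //; lia.
Qed.

Let z0_step N j : z 0 N.+1 j = q j * z 0 N j.
Proof. rewrite /z X_step addr0 /q exprS /mu; field; rewrite expf_neq0 //= lt0r_neq0 //. Qed.

Let z_step r N j :
  z r.+1 N.+1 j = q j * z r.+1 N j + S (j * L.+2) / mu * zeta r N L.+2.
Proof.
rewrite /z X_step /q /zeta exprS.
have -> : mu ^+ N = (2 * cos theta) ^+ N by [].
rewrite /mu; field.
by rewrite expf_neq0 ?lt0r_neq0 //= lt0r_neq0 //.
Qed.

Let zeta_step r N h : zeta r N.+1 h.+1 = mu^-1 * zeta r N h +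
  mu^-1 * (if ('C(h.+1, L.+1) <= r)%N then zeta (r - 'C(h.+1, L.+1))%N N h.+2 else 0).
Proof.
rewrite /zeta /P pathsSS natrD exprS.
by case: ifP => _; field; rewrite mu_neq0 expf_neq0.
Qed.

(** In the inversion formula the modes 1 and [L.+2] agree up to the sign [(-1) ^ (N + h)]; together
    they double or cancel, whence the factor 4 and the parity indicator. *)
Let zeta_inv r N h : (h < L.+2)%N ->
  zeta r N h = 4 / L.+3%:R * S h.+1 * ((~~ odd (N + h))%:R * z r N 1) +
    2 / L.+3%:R * \sum_(i < L) S (i.+2 * h.+1) * z r N i.+2.
Proof.
move=> hL; rewrite /zeta P_inv // big_ord_recr 2!big_ord_recl /= !mul0n mul1n.
rewrite X_top S_reflect S0 mul0r add0r.
have -> : \sum_(i < L) S (lift ord0 (lift ord0 i) * h.+1) * X r N (lift ord0 (lift ord0 i))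
    = (\sum_(i < L) S (i.+2 * h.+1) * z r N i.+2) * mu ^+ N.
  rewrite mulr_suml; apply: eq_bigr => i _; rewrite /z /= /bump /= !add1n.
  by rewrite -mulrA divfK ?expf_neq0.
have -> : (~~ odd (N + h))%:R = (1 + (-1) ^+ N * (-1) ^+ h) / 2 :> R.
  rewrite -exprD -signr_odd; case: odd; first by rewrite expr1 subrr mul0r.
  by rewrite mulr1n expr0; field.
have l0 : L.+3%:R != 0 :> R by rewrite pnatr_eq0.
rewrite -[bump 0 0]/1%N /z; move: (L.+3%:R : R) l0 => l l0; field.
by rewrite l0 expf_neq0.
Qed.

Let rho_exists : exists rho : R,
  [/\ 0 < rho, rho < 1 & forall i, (i < L)%N -> `|q i.+2| <= rho].
Proof.
suff H n : (n <= L)%N -> exists rho : R,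
    [/\ 0 < rho, rho < 1 & forall i, (i < n)%N -> `|q i.+2| <= rho] by exact: H.
elim: n => [|n IH] nL; first by exists 2^-1; split=> //; lra.
have [rho [r0 r1 Hr]] := IH (ltnW nL).
exists (Num.max rho `|q n.+2|); split.
- by rewrite lt_max r0.
- by rewrite gt_max r1 q_lt1.
- move=> i; rewrite ltnS leq_eqVlt le_max => /orP[/eqP->|/Hr->//].
  by rewrite lexx orbT.
Qed.

Let amp : R := 4 * S 1 ^+ 2 / L.+3%:R.
(* These constants solve c r.+1 * 2 (r+1) = amp / mu^2 * c r, see main_step. *)
Let c r : R := S 1 * (amp / (2 * mu ^+ 2)) ^+ r / (r`!)%:R.

(** * Induction on the cost *)

Section Induction.
Variable rho : R.
Hypotheses (rho_gt0 : 0 < rho) (rho_lt1 : rho < 1).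
Hypothesis q_rho : forall i, (i < L)%N -> `|q i.+2| <= rho.

(** The three claims carried by the induction. The last, cruder one also covers heights above the
    strip, which the sine transform does not see. *)
Let main_negl r := negl rho r (fun N => z r N 1 - c r * N%:R ^+ r).
Let mid_negl r := forall i, (i < L)%N -> negl rho r (fun N => z r N i.+2).
Let zeta_bound r := forall h, negl rho r.+1 (fun N => zeta r N h).

Let zeta_negl r h : main_negl r -> mid_negl r -> (h < L.+2)%N ->
  negl rho r (fun N => zeta r N h -
    4 / L.+3%:R * S h.+1 * ((~~ odd (N + h))%:R * (c r * N%:R ^+ r))).
Proof.
move=> Hz Hm hL.
have Hs := negl_sum (fun i iL => neglZ (S (i.+2 * h.+1)) (Hm i iL)).
apply: eq_negl (neglD (neglZ (4 / L.+3%:R * S h.+1)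
  (negl_pred (fun N => ~~ odd (N + h)) Hz)) (neglZ (2 / L.+3%:R) Hs)) => N.
by rewrite zeta_inv //=; ring.
Qed.

(** Above the strip, induct on the height: a first step goes down, or goes up at positive cost and
    is bounded by a smaller [r]. *)
Let zeta_bound_step r : main_negl r -> mid_negl r ->
  (forall s, (s < r)%N -> zeta_bound s) -> zeta_bound r.
Proof.
move=> Hz Hm Hb; elim=> [|h IH].
  apply: eq_negl (neglD (neglS rho_gt0 rho_lt1 (zeta_negl Hz Hm (ltn0Sn _)))
    (neglZ (4 / L.+3%:R * S 1)
      (negl_pred (fun N => ~~ odd (N + 0)) (neglZ (c r) (negl_exprn rho r))))) => N.
  by rewrite subrK.
have [hL|hL] := ltnP h.+1 L.+2.
  apply: eq_negl (neglD (neglS rho_gt0 rho_lt1 (zeta_negl Hz Hm hL))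
    (neglZ (4 / L.+3%:R * S h.+2)
      (negl_pred (fun N => ~~ odd (N + h.+1)) (neglZ (c r) (negl_exprn rho r))))) => N.
  by rewrite subrK.
apply: negl_unshift => //.
apply: eq_negl (fun N => esym (zeta_step r N h)) _.
apply: neglD (neglZ _ IH) (neglZ _ _).
have C0 : (0 < 'C(h.+1, L.+1))%N by rewrite bin_gt0; lia.
case: (leqP 'C(h.+1, L.+1) r) => hr; last exact: negl0.
by apply: neglW (Hb _ _ _) => //; lia.
Qed.

(** From height [k] a first step down enters the strip at its top, which gives the main term; a
    first step up costs at least 1, which lowers the order. *)
Let source_negl r : main_negl r -> mid_negl r -> (forall s, (s < r)%N -> zeta_bound s) ->
  negl rho r (fun N => zeta r N L.+2 -
    4 / L.+3%:R * S 1 * mu^-1 * ((~~ odd (N + L.+2))%:R * (c r * N%:R ^+ r))).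
Proof.
move=> Hz Hm Hb; apply: negl_unshift => //.
have Hx : negl rho r (fun N => if ('C(L.+2, L.+1) <= r)%N
    then zeta (r - 'C(L.+2, L.+1)) N L.+3 else 0).
  have C0 : (0 < 'C(L.+2, L.+1))%N by rewrite bin_gt0.
  case: (leqP 'C(L.+2, L.+1) r) => hr; last exact: negl0.
  by apply: neglW (Hb _ _ _) => //; lia.
have := neglB (neglD (neglZ mu^-1 (zeta_negl Hz Hm (ltnSn L.+1))) (neglZ mu^-1 Hx))
  (neglZ (4 / L.+3%:R * S 1 * mu^-1)
    (negl_pred (fun N => ~~ odd (N.+1 + L.+2)) (neglZ (c r) (negl_diff_exprn rho_gt0 rho_lt1 r)))).
apply: eq_negl => N; rewrite zeta_step S_last.
have -> : odd (N.+1 + L.+2) = odd (N + L.+1) by rewrite !addnS !addSn /= negbK.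
by ring.
Qed.

(** Since [q 1 = 1], a two-step difference of the first mode is the sum of two consecutive sources,
    only one of which has the right parity. It is matched with the leading term [2 (r + 1) N ^ r] of
    the difference of [N ^ (r + 1)]. *)
Let main_step r : main_negl r -> mid_negl r -> (forall s, (s < r)%N -> zeta_bound s) ->
  main_negl r.+1.
Proof.
move=> Hz Hm Hb; have Hg := source_negl Hz Hm Hb.
apply: negl_sum2 => //.
pose k0 := 4 / L.+3%:R * S 1 * mu^-1 * c r.
have Hd := negl_diff_exprn rho_gt0 rho_lt1 r.
have := neglB (neglD (neglZ (S 1 / mu) (neglD Hg (negl_shift rho_gt0 rho_lt1 Hg)))
   (neglZ (S 1 / mu * k0) (negl_pred (fun N => ~~ odd (N.+1 + L.+2)) Hd)))
   (neglZ (c r.+1) (negl_diff2_exprn rho_gt0 rho_lt1 r)).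
apply: eq_negl => N; rewrite !z_step mul1n S_last.
have -> : q 1 = 1 by rewrite /q mulr1n divff // lt0r_neq0.
have ck : c r.+1 * (2 * r.+1%:R) = S 1 / mu * k0.
  rewrite /k0 /c factS natrM exprS.
  have l0 : L.+3%:R != 0 :> R by rewrite pnatr_eq0.
  have r0 : r.+1%:R != 0 :> R by rewrite pnatr_eq0.
  have f0 : (r`!)%:R != 0 :> R by rewrite pnatr_eq0 -lt0n fact_gt0.
  move: ((amp / _) ^+ r) => w; rewrite /amp; move: (L.+3%:R : R) l0 (r.+1%:R : R) r0 => l l0 r1 r0.
  by field; rewrite mu_neq0 f0 r0 l0.
have par : (~~ odd (N + L.+2))%:R = 1 - (~~ odd (N.+1 + L.+2))%:R :> R.
  by rewrite addSn /=; case: odd; rewrite ?subrr ?subr0.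
apply/eqP; rewrite -subr_eq0 par; apply/eqP.
transitivity ((c r.+1 * (2 * r.+1%:R) - S 1 / mu * k0) * N%:R ^+ r); last first.
  by rewrite ck subrr mul0r.
rewrite /k0; move: (N.+2%:R ^+ r.+1) (N%:R ^+ r.+1) (N.+1%:R ^+ r) (N%:R ^+ r) => A1 A2 A3 A4.
by move: (L.+3%:R^-1) mu^-1 (r.+1%:R : R) => l m r1; ring.
Qed.

(** For cost 0 there is no source: the first mode is constant and the middle modes decay like
    [rho ^ N]. Afterwards the middle modes contract and keep the order of their source. *)
Lemma strip_asymptotics r : [/\ main_negl r, mid_negl r & zeta_bound r].
Proof.
elim/ltn_ind: r => r IH.
have Hb s : (s < r)%N -> zeta_bound s by move=> /IH[].
suff [Hz Hm] : main_negl r /\ mid_negl r by split=> //; exact: zeta_bound_step.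
case: r IH Hb => [|r] IH Hb.
  split.
    apply: eq_negl (negl0 rho 0) => N; rewrite expr0 mulr1 /c expr0 mulr1 divr1.
    elim: N => [|N IHN]; last by rewrite z0_step /q mulr1n divff ?mul1r // lt0r_neq0.
    rewrite /z /X expr0 divr1 big_ord_recl big1 ?addr0 ?mul1n.
      by rewrite /P /= mulr1 subrr.
    by move=> i _; rewrite /P /= mulr0.
  move=> i iL; exists `|z 0 0 i.+2| => N.
  elim: N => [|N IHN]; first by rewrite /= expr0 mulr1.
  rewrite z0_step normrM /= exprS mulrCA ler_pM //; exact: q_rho.
have [Hz Hm Hbr] := IH r (ltnSn r).
have Hb' s : (s < r)%N -> zeta_bound s by move=> sr; apply: Hb; rewrite ltnS ltnW.
split; first exact: main_step.
move=> i iL; apply: negl_contract (q_lt1 iL) _ => //.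
apply: eq_negl (neglZ (S (i.+2 * L.+2) / mu) (Hbr L.+2)) => N.
by rewrite z_step addrAC subrr add0r.
Qed.

Lemma paths_home r : negl rho r (fun N => zeta r N 0 -
  4 / L.+3%:R * S 1 * ((~~ odd (N + 0))%:R * (c r * N%:R ^+ r))).
Proof. by have [Hz Hm _] := strip_asymptotics r; apply: zeta_negl. Qed.
End Induction.

Let main r n : R := (4 * sin theta ^+ 2 / L.+3%:R) ^+ r.+1 * (n%:R ^+ r / (r`!)%:R)
  * (4 * cos theta ^+ 2) ^+ (n - r).

Lemma paths_asymptotics r : exists C : R, forall n, (0 < n)%N -> (r <= n)%N ->
  main r n != 0 /\ `|(paths L.+1 n.*2 r 0)%:R / main r n - 1| <= C / n%:R.
Proof.
have [rho [rho0 rho1 Hq]] := rho_exists.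
have [C HC] := paths_home rho0 rho1 Hq r.
have C0 := negl_const_ge0 HC.
pose A := amp ^+ r.+1 / (r`!)%:R / mu ^+ r.*2.
have l0 : L.+3%:R != 0 :> R by rewrite pnatr_eq0.
have amp0 : 0 < amp by rewrite /amp divr_gt0 ?ltr0n // mulr_gt0 ?exprn_gt0.
have f0 : 0 < (r`!)%:R :> R by rewrite ltr0n fact_gt0.
have A0 : 0 < A by rewrite /A !divr_gt0 ?exprn_gt0.
pose D := 3 ^+ r * (1 - rho)^-1.
exists (C * D / A) => n n0 rn.
have n0' : 0 < n%:R :> R by rewrite ltr0n.
have nr0 : 0 < n%:R ^+ r :> R by rewrite exprn_gt0.
have mainE : main r n = A * n%:R ^+ r * mu ^+ n.*2.
  rewrite /main -[sin theta]/(S 1) -/amp.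
  have -> : 4 * cos theta ^+ 2 = mu ^+ 2 by rewrite /mu exprMn -natrX.
  rewrite -exprM mul2n doubleB -[in RHS](subnK (_ : r.*2 <= n.*2)%N) ?leq_double //.
  rewrite exprD /A; field.
  by rewrite expf_neq0 //= lt0r_neq0.
have main0 : main r n != 0.
  by rewrite mainE; apply/lt0r_neq0/mulr_gt0; [exact: mulr_gt0|exact: exprn_gt0].
split=> //.
have -> : (paths L.+1 n.*2 r 0)%:R / main r n - 1 =
    (zeta r n.*2 0 - A * n%:R ^+ r) / (A * n%:R ^+ r).
  rewrite mainE /zeta /P; field.
  by rewrite (lt0r_neq0 nr0) (lt0r_neq0 A0) expf_neq0.
(* At the even time [2 n] the parity indicator is 1, and [(2 n) ^ r] cancels the [2 ^ r] in
   [c r]. *)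
have AE : A * n%:R ^+ r = 4 / L.+3%:R * S 1 *
    ((~~ odd (n.*2 + 0))%:R * (c r * n.*2%:R ^+ r)) :> R.
  have m0 : mu ^+ r.*2 != 0 by rewrite expf_neq0.
  have t0 : 2 ^+ r != 0 :> R by rewrite expf_neq0.
  have -> : (~~ odd (n.*2 + 0))%:R = 1 :> R by rewrite addn0 odd_double.
  have -> : n.*2%:R ^+ r = n%:R ^+ r * 2 ^+ r :> R by rewrite -muln2 natrM exprMn.
  have cE : c r = S 1 * (amp ^+ r / (2 ^+ r * mu ^+ r.*2)) / (r`!)%:R.
    rewrite /c; congr (_ * _ / _); move: amp mu => a m.
    by rewrite expr_div_n exprMn -exprM mul2n.
  rewrite cE /A exprS; move: (amp ^+ r) (mu ^+ r.*2) (2 ^+ r) m0 t0 => w1 w2 w3 m0 t0.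
  rewrite /amp; move: (L.+3%:R : R) l0 => l l0.
  by field; rewrite t0 m0 l0 lt0r_neq0.
have := HC n.*2; rewrite -AE => H.
rewrite normrM normfV (gtr0_norm (mulr_gt0 A0 nr0)) ler_pdivrMr ?(mulr_gt0 A0 nr0) //.
apply: le_trans H _.
have -> : C * D / A / n%:R * (A * n%:R ^+ r) = C * (D * n%:R ^+ r / n%:R).
  by field; rewrite !lt0r_neq0.
by rewrite ler_wpM2l // ler_pdivlMr // scale_double.
Qed.

End Strip.

(** * Small [k] and the final estimate *)

Local Open Scope classical_set_scope.
Local Open Scope ring_scope.

(** With [K = 0] every up step costs 1, so a path of cost [r] has length exactly [2 r + h]. *)
Lemma paths0_large N r h : (r.*2 + h < N)%N -> paths 0 N r h = 0%N.
Proof.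
elim: N r h => // N IH r h ltN /=; rewrite bin0.
have -> : (if h is h'.+1 then paths 0 N r h' else 0)%N = 0%N.
  by case: h ltN => // h ltN; apply: IH; lia.
by case: r ltN => // r ltN; rewrite /= subn1 /= IH //; lia.
Qed.

Lemma num_av132_k0 n r : r <> 1%N -> num_av132 n 0 r = 0%N.
Proof.
move=> r1; apply/eqP; rewrite cards_eq0; apply/eqP/setP => p; rewrite !inE.
suff -> : occurrences (pattern_id 0) p = 1%N by case: eqP => [/esym//|_]; rewrite andbF.
rewrite occurrences_id_sets (_ : [set A | _] = [set finset.set0])%SET ?cards1 //.
apply/setP => A; rewrite !inE cards_eq0; case: eqP => //= ->.
by apply/increasing_onP => i j; rewrite inE.
Qed.

(** For [k = 0] the empty pattern occurs once in each permutation while [sin pi = 0], so the formula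
    fails at [r = 1]. For [k = 1] both sides vanish once [n > r]. Otherwise [e] is the exact
    relative error. *)
Theorem theorem5 (R : realType) (r k : nat)
    (hkr : ~ (k = 0%N /\ r = 1%N)) :
  exists e : nat -> R,
    e =O_\oo (fun n : nat => (n%:R : R)^-1) /\
    \forall n \near \oo,
      (num_av132 n k r)%:R =
        (4 * sin (pi / k.+1%:R) ^+ 2 / k.+1%:R) ^+ r.+1
        * (n%:R ^+ r / (r`!)%:R)
        * (4 * cos (pi / k.+1%:R) ^+ 2) ^+ (n - r)
        * (1 + e n).
Proof.
case: k hkr => [|[|L]] hkr.
- exists (fun=> 0); split; first by apply/eqO_exP; exists 1 => //; near=> n; rewrite normr0.
  near=> n; rewrite num_av132_k0; last by move=> r1; apply: hkr.
  have -> : pi / 1%:R = pi :> R by rewrite divr1.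
  by rewrite sinpi expr0n mulr0 mul0r expr0n !mul0r.
- exists (fun=> 0); split; first by apply/eqO_exP; exists 1 => //; near=> n; rewrite normr0.
  exists r.+1 => // n /= rn; rewrite num_av132_paths paths0_large ?addn0 ?ltn_double //.
  by rewrite cos_pihalf expr0n mulr0 expr0n subn_eq0 leqNgt rn /= mulr0 mul0r.
have [C HC] := paths_asymptotics R L r.
exists (fun n => (num_av132 n L.+2 r)%:R /
  ((4 * sin (pi / L.+3%:R) ^+ 2 / L.+3%:R) ^+ r.+1 * (n%:R ^+ r / (r`!)%:R)
    * (4 * cos (pi / L.+3%:R) ^+ 2) ^+ (n - r)) - 1); split.
  (* [eqO_exP] asks for a positive constant. *)
  apply/eqO_exP; exists (`|C| + 1); first by rewrite ltr_wpDl.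
  exists r.+1 => // n /= rn; have [_] := HC n (leq_ltn_trans (leq0n _) rn) (ltnW rn).
  rewrite -num_av132_paths => /le_trans; apply.
  rewrite normfV normr_nat ler_wpM2r ?invr_ge0 //.
  by rewrite (le_trans (ler_norm _)) // lerDl.
exists r.+1 => // n /= rn; have [m0 _] := HC n (leq_ltn_trans (leq0n _) rn) (ltnW rn).
by rewrite [1 + _]addrC subrK [RHS]mulrC divfK.
Unshelve. all: by end_near.
Qed.
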